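(* Let $n\ge2$. The symplectic design $S^-(n)$ admits a flag-transitive but point-imprimitive group of automorphisms isomorphic to $2^{2n}:\mathrm{GL}(n,2)$, preserving the structure of a grid on the point set. That is, there is a subgroup $G$ of $\mathrm{Aut}(S^-(n))$, isomorphic to the semidirect product of the translation group of $V\oplus V^*$ by $\mathrm{GL}(V)$, where $V$ is an $n$-dimensional vector space over $\mathrm{GF}(2)$ and $\mathrm{GL}(V)$ acts naturally on $V$ and by the inverse-transpose action on the dual space $V^*$, such that $G$ is transitive on the flags (incident point-block pairs) of $S^-(n)$ and such that, under an identification of the point set with $V\oplus V^*$, the group $G$ acts in the natural way (as translations and linear maps), so that the family of cosets of $V$ and the family of cosets of $V^*$ are both systems of imprimitivity for $G$ on points, giving the point set the structure of a square $2^n\times 2^n$ grid.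
   Context: The design $S^\epsilon(n)$, for $\epsilon\in\{+,-\}$ (identified with $\pm1$) and $n\ge2$, is defined as follows. Let $W$ be a $2n$-dimensional vector space over $\mathrm{GF}(2)$ and $f$ a fixed (non-degenerate) symplectic form on $W$. There are $2^{2n}$ quadratic forms $Q$ on $W$ polarising to $f$, that is, satisfying $Q(x+y)=Q(x)+Q(y)+f(x,y)$ for all $x,y\in W$. Each such $Q$ has a type $\mathrm{tp}(Q)\in\{+,-\}$, where a form of type $\epsilon$ has $2^{n-1}(2^n+\epsilon)$ zeros in $W$. The points of $S^\epsilon(n)$ are the vectors in $W$, the blocks are the quadratic forms polarising to $f$, and the vector $w$ and form $Q$ are incident if and only if $(-1)^{Q(w)}=\epsilon\,\mathrm{tp}(Q)$. It is a symmetric $2$-$(2^{2n},2^{n-1}(2^n+\epsilon),2^{n-1}(2^{n-1}+\epsilon))$ design. *)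

(* Defs.v *)
From HB Require Import structures.
From mathcomp Require Import all_boot all_order all_fingroup all_algebra.
From mathcomp Require Import all_solvable zify.

Set Implicit Arguments.
Unset Strict Implicit.
Unset Printing Implicit Defensive.

Import GRing.Theory Num.Theory.
Local Open Scope ring_scope.

Section IncidenceStructures.

Variables (P B : finType) (I : P -> B -> bool).

(* An automorphism is a permutation of the points together with a permutation *)
(* of the blocks that preserve incidence.                                     *)
Definition inc_aut : {set {perm P} * {perm B}} :=
  [set g : {perm P} * {perm B} |
    [forall p, forall b, I (g.1 p) (g.2 b) == I p b]].

Lemma inc_autP (g : {perm P} * {perm B}) :
  reflect (forall p b, I (g.1 p) (g.2 b) = I p b) (g \in inc_aut).
Proof.
rewrite inE; apply: (iffP forallP) => [gI p b | gI p].
  by apply/eqP; move/forallP: (gI p).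
by apply/forallP => b; rewrite gI.
Qed.

Lemma inc_aut_group_set : group_set inc_aut.
Proof.
apply/group_setP; split=> [|g h /inc_autP gI /inc_autP hI]; apply/inc_autP.
  by move=> p b; rewrite !perm1.
by move=> p b; rewrite !permM hI gI.
Qed.

Canonical inc_aut_group := Group inc_aut_group_set.

Definition flags : {set P * B} := [set x | I x.1 x.2].

End IncidenceStructures.

Section IncidenceActions.

Variables P B : finType.

Definition point_act_fun (p : P) (g : {perm P} * {perm B}) : P := g.1 p.

Lemma point_act1 : point_act_fun^~ 1%g =1 id.
Proof. by move=> p; apply: perm1. Qed.

Lemma point_actM p : act_morph point_act_fun p.
Proof. by move=> g h; apply: permM. Qed.

Definition point_act : {action {perm P} * {perm B} &-> P} :=
  TotalAction point_act1 point_actM.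

Definition flag_act_fun (x : P * B) (g : {perm P} * {perm B}) : P * B :=
  (g.1 x.1, g.2 x.2).

Lemma flag_act1 : flag_act_fun^~ 1%g =1 id.
Proof. by case=> p b; rewrite /flag_act_fun /= !perm1. Qed.

Lemma flag_actM x : act_morph flag_act_fun x.
Proof. by move=> g h; rewrite /flag_act_fun /= !permM. Qed.

Definition flag_act : {action {perm P} * {perm B} &-> P * B} :=
  TotalAction flag_act1 flag_actM.

End IncidenceActions.

Arguments point_act {P B}.
Arguments flag_act {P B}.

Definition square_grid (P : finType) (m : nat) (rows cols : {set {set P}}) :=
  [/\ partition rows [set: P], partition cols [set: P],
      #|rows| = m, #|cols| = m
    & forall r c, r \in rows -> c \in cols -> #|r :&: c| = 1%N].

Lemma sqr_diff_zeros (n z : nat) : (0 < n)%N ->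
    (z%:R - (2 ^+ (2 * n) - z%:R)) ^+ 2 = 2 ^+ (2 * n) :> int ->
  z%:Z = 2 ^+ n.-1 *
    (2 ^+ n + if z == (2 ^ n.-1 * (2 ^ n + 1))%N then 1 else -1).
Proof.
case: n => // n _ /=; rewrite mulnC exprM => /eqP.
have bE : 2 ^+ n = (2 ^ n)%:Z :> int by rewrite -natz natrX.
have aE : 2 ^+ n.+1 = 2 * (2 ^ n)%:Z :> int by rewrite exprS bE.
have b_gt0 : (0 < 2 ^ n)%N by rewrite expn_gt0.
rewrite aE expnS bE natz; move: (2 ^ n)%N b_gt0 => b b_gt0 {aE bE}.
rewrite eqf_sqr => /orP[] /eqP; rewrite expr2 => zE; case: eqP => zb; nia.
Qed.

Section SymplecticDesign.

Variable n : nat.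

Local Notation W := 'rV['F_2]_(2 * n).

(* Over GF(2) this identity is all there is to being a quadratic form with    *)
(* polarisation f: it gives Q 0 = 0, hence Q (a *: x) = a ^+ 2 * Q x.         *)
Definition polarises (f : W -> W -> 'F_2) (Q : {ffun W -> 'F_2}) : bool :=
  [forall x, forall y, Q (x + y) == Q x + Q y + f x y].

Definition quad_form (f : W -> W -> 'F_2) : predArgType :=
  {Q : {ffun W -> 'F_2} | polarises f Q}.

Definition zeros (Q : {ffun W -> 'F_2}) : {set W} := [set w | Q w == 0].

(* The sign e such that Q has 2 ^ (n - 1) * (2 ^ n + e) zeros; see [tpP].     *)
Definition tp (Q : {ffun W -> 'F_2}) : int :=
  if #|zeros Q| == (2 ^ n.-1 * (2 ^ n + 1))%N then 1 else -1.

(* Incidence in S^eps(n), where eps is 1 or -1.                               *)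
Definition incident (eps : int) (f : W -> W -> 'F_2) (w : W) (Q : quad_form f)
    : bool :=
  (-1) ^+ (val Q w : nat) == eps * tp (val Q).

Lemma sign_F2D (a b : 'F_2) :
  (-1) ^+ (a + b)%R = (-1) ^+ a * (-1) ^+ b :> int.
Proof. by case: a b => [[|[|[]]] //= ?] [[|[|[]]] //= ?]. Qed.

Lemma sign_F2_neq0 (a : 'F_2) : a != 0 -> (-1) ^+ a = -1 :> int.
Proof. by case: a => [[|[|[]]]]. Qed.

Lemma sign_sum_sqr (f : {skew_symmetric W}) (Q : {ffun W -> 'F_2}) :
    is_psymplectic f -> polarises f Q ->
  (\sum_w (-1) ^+ Q w) ^+ 2 = (2 ^ (2 * n))%:R :> int.
Proof.
case=> nd_f _ _ /'forall_forallP/= Qf.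
have fE x z : Q x + Q (x + z) = Q z + f x z.
  rewrite (eqP (Qf x z)) !addrA.
  have -> : Q x + Q x = 0 by rewrite -mulr2n mulrn_pchar // pchar_Fp.
  by rewrite add0r.
rewrite expr2 mulr_suml.
under [LHS]eq_bigr => x _.
  rewrite mulr_sumr (reindex_inj (addrI x)) /=.
  under eq_bigr => z _ do rewrite -sign_F2D fE sign_F2D.
  over.
rewrite exchange_big /= (bigD1 0) //= [X in _ + X]big1 => [|z nz_z].
  have Q0 : Q 0 = 0.
    by have := fE 0 0; rewrite linear0r !addr0 -mulr2n mulrn_pchar ?pchar_Fp.
  rewrite addr0; under eq_bigr => x _ do rewrite Q0 linear0r mulr1.
  by rewrite sumr_const card_mx card_Fp // mul1n.
rewrite -mulr_sumr; set s := \sum_i _; suff -> : s = 0 by rewrite mulr0.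
have [x0 fx0] : exists x0, f x0 z != 0.
  apply/existsP; apply: contraR nz_z; rewrite negb_exists => /forallP /= f0.
  rewrite -memv0 -(eqP nd_f); apply/mem_orthovP => y _.
  by rewrite hermC; move: (f0 y); rewrite negbK => /eqP ->; rewrite /= mulr0.
suff /eqP : s = - s by rewrite -subr_eq0 opprK -mulr2n mulrn_eq0 => /eqP.
rewrite {1}/s (reindex_inj (addrI x0)) /= -sumrN; apply: eq_bigr => x _.
by rewrite linearDl sign_F2D (sign_F2_neq0 fx0) mulN1r.
Qed.

Lemma tpP (f : {skew_symmetric W}) (Q : {ffun W -> 'F_2}) :
    (0 < n)%N -> is_psymplectic f -> polarises f Q ->
  #|zeros Q|%:Z = 2 ^+ n.-1 * (2 ^+ n + tp Q).
Proof.
move=> n_gt0 hf hQ; have := sign_sum_sqr hf hQ.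
have cW : (#|zeros Q| + #|~: zeros Q| = 2 ^ (2 * n))%N.
  by rewrite cardsC card_mx card_Fp // mul1n.
have -> : \sum_w (-1) ^+ Q w = #|zeros Q|%:R - #|~: zeros Q|%:R :> int.
  rewrite (bigID (mem (zeros Q))) /=; congr (_ + _).
    under eq_bigr => w; first by rewrite inE => /eqP ->; over.
    by rewrite sumr_const.
  rewrite (eq_bigr (fun=> - 1)) => [|w]; last by rewrite inE => /sign_F2_neq0.
  rewrite sumr_const mulNrn; congr (- _%:R).
  by apply: eq_card => w; rewrite [RHS]inE unfold_in.
have -> : #|~: zeros Q|%:R = 2 ^+ (2 * n) - #|zeros Q|%:R :> int.
  by rewrite -natrX -cW natrD addrAC subrr add0r.
by rewrite natrX /tp; apply: sqr_diff_zeros.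
Qed.

End SymplecticDesign.

(* The elements of {'GL_n['F_2]} are matrices of size n.-1.+1 by definition;  *)
(* this is n as soon as 0 < n. In sumV n, the first component is a vector v   *)
(* of V and the second one the coordinates phi, in the dual basis, of the     *)
(* linear functional v |-> v *m phi^T in V^*.                                 *)
Notation natV n := 'rV['F_2]_n.-1.+1.
Notation sumV n := (natV n * natV n)%type.

Section NaturalAction.

Variable n : nat.

Definition GLact_fun (x : sumV n) (A : {'GL_n['F_2]}) : sumV n :=
  (x.1 *m A, x.2 *m (invmx A)^T).

Lemma GLact_pairing x A :
  (GLact_fun x A).1 *m (GLact_fun x A).2^T = x.1 *m x.2^T.
Proof.
rewrite /GLact_fun /= trmx_mul trmxK mulmxA -(mulmxA x.1) mulmxV ?mulmx1 //.
exact: GL_unitmx.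
Qed.

Lemma GLact1 : GLact_fun^~ 1%g =1 id.
Proof. by case=> v phi; rewrite /GLact_fun /= invmx1 trmx1 !mulmx1. Qed.

Lemma GLactM x : act_morph GLact_fun x.
Proof.
move=> A B; rewrite /GLact_fun /=; congr (_, _); first exact: mulmxA.
have -> : invmx (GLval (A * B)%g) = invmx (GLval B) *m invmx (GLval A).
  exact: (congr1 (@GLval _ _) (invMg A B)).
by rewrite trmx_mul mulmxA.
Qed.

Definition GLact : {action {'GL_n['F_2]} &-> sumV n} :=
  TotalAction GLact1 GLactM.

Lemma GLact_is_groupAction : is_groupAction [set: sumV n] GLact.
Proof.
move=> A _; rewrite inE; apply/andP; split.
  by apply/subsetP=> x; rewrite inE.
by apply/morphicP=> x y _ _; rewrite !actpermE /= /GLact_fun !mulmxDl.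
Qed.

Definition GLgact : groupAction [set: {'GL_n['F_2]}] [set: sumV n] :=
  GroupAction GLact_is_groupAction.

Definition affGL : finGroupType := sdprod_by GLgact.

(* The subspaces V and V^* of V (+) V^*.                                      *)
Definition summand1 : {set sumV n} := [set x | x.2 == 0].
Definition summand2 : {set sumV n} := [set x | x.1 == 0].

End NaturalAction.

(* The group structure on sumV n is the additive one, so rcosets are the      *)
(* translates of U.                                                           *)
Definition pulled_cosets (n : nat) (P : finType) (phi : P -> sumV n)
    (U : {set sumV n}) : {set {set P}} :=
  [set phi @^-1: (C : {set sumV n}) | C in rcosets U [set: sumV n]].

(* Main.v *)
(** A symplectic basis identifies W with V (+) V^*, the form becoming the
    polarisation [polar] of the hyperbolic form q(v, phi) = phi(v). The forms
    polarising to f are then Q_u = q + polar(-, u), and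
    Q_u(w) = q(w + u) + q(u). Since q has more zeros than nonzeros, Q_u has
    type (-1)^q(u), so in S^-(n) the point w lies on the block Q_u iff
    q(w + u) = 1. Hence every affine map x |-> A x + t with A in GL(V), acting
    simultaneously on the points w and on the block parameters u, preserves
    incidence. As GL(V) is transitive on the vectors with q = 1, this group is
    transitive on flags. *)

From HB Require Import structures.
Require Import Defs.
From mathcomp Require Import all_boot all_order all_fingroup all_algebra.
From mathcomp Require Import all_solvable zify ring.

Set Implicit Arguments.
Unset Strict Implicit.
Unset Printing Implicit Defensive.

Import GRing.Theory.
Local Open Scope ring_scope.

(** * Hyperbolic pairs for a nondegenerate alternating form *)

Section SymplecticBasis.

Variables (F : fieldType) (vT : vectType F) (f : {skew_symmetric vT}).
Hypothesis nd_f : nondegenerate f.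
Hypothesis alt_f : forall u, f u u = 0.

(** The families are total on [nat] and constrained only below [k], so the induction can extend them
    by overriding the value at [k]. *)
Definition hyperbolic_pairs (k : nat) (b c : nat -> vT) :=
  forall i j, (i < k)%N -> (j < k)%N ->
  [/\ f (b i) (b j) = 0, f (c i) (c j) = 0 & f (b i) (c j) = (i == j)%:R].

Lemma skew_formC u v : f u v = - f v u.
Proof. by rewrite hermC /= expr1 mulN1r. Qed.

(** This is [z] minus its projection to the span of the pairs. The inner minus sign compensates for
    [f (c i) (b i) = -1]. *)
Definition hyperbolic_residue (k : nat) (b c : nat -> vT) (z : vT) : vT :=
  z - (\sum_(i < k) f z (c i) *: b i - \sum_(i < k) f z (b i) *: c i).

Lemma hyperbolic_residue_orth k b c z j :
    hyperbolic_pairs k b c -> (j < k)%N ->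
  f (hyperbolic_residue k b c z) (b j) = 0 /\
  f (hyperbolic_residue k b c z) (c j) = 0.
Proof.
move=> bc jk; rewrite /hyperbolic_residue !linearBl /= !linear_sumlz /=.
split.
  rewrite big1 => [|i _]; last first.
    by have [bb _ _] := bc _ _ (ltn_ord i) jk; rewrite linearZl_LR /= bb mulr0.
  rewrite (bigD1 (Ordinal jk)) //= big1 => [|i nij]; last first.
    have [_ _ b_c] := bc _ _ jk (ltn_ord i).
    by rewrite linearZl_LR /= [f (c i) _]skew_formC b_c eq_sym -[j]/(val
      (Ordinal jk)) (inj_eq val_inj) (negPf nij) oppr0 mulr0.
  have [_ _ b_c] := bc _ _ jk jk.
  by rewrite linearZl_LR /= [f (c j) _]skew_formC b_c eqxx mulrN1 addr0 sub0r
    opprK subrr.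
rewrite [X in _ - (_ - X)]big1 => [|i _]; last first.
  by have [_ cc _] := bc _ _ (ltn_ord i) jk; rewrite linearZl_LR /= cc mulr0.
rewrite (bigD1 (Ordinal jk)) //= big1 => [|i nij]; last first.
  have [_ _ b_c] := bc _ _ (ltn_ord i) jk.
  by rewrite linearZl_LR /= b_c -[j]/(val (Ordinal jk)) (inj_eq val_inj) (negPf
    nij) mulr0.
have [_ _ b_c] := bc _ _ jk jk.
by rewrite linearZl_LR /= b_c eqxx mulr1 addr0 subr0 subrr.
Qed.

(** Symplectic Gram-Schmidt: by dimension some [x0] lies outside the span of the first [k] pairs, so
    its residue is nonzero. Nondegeneracy then supplies a partner, which is scaled and replaced by
    its residue. *)
Lemma hyperbolic_pairs_exist k :
  (k.*2 <= \dim {:vT})%N -> exists b c, hyperbolic_pairs k b c.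
Proof.
elim: k => [|k IHk] le_k; first by exists (fun=> 0), (fun=> 0).
have [|b [c bc]] := IHk; first by apply: leq_trans le_k; rewrite leq_double.
pose p := hyperbolic_residue k b c.
pose s := mkseq b k ++ mkseq c k.
have [x0 x0s] : exists x0, x0 \notin <<s>>%VS.
  have [/subvP sub | /subvPn[x0 _ ?]] := boolP ({:vT} <= <<s>>)%VS;
    last by exists x0.
  have /dimvS := introT subvP sub; rewrite leqNgt (leq_ltn_trans (dim_span s))
    //.
  by rewrite size_cat !size_mkseq addnn; apply: leq_trans le_k;
    rewrite ltn_double.
have nz_px : p x0 != 0.
  apply: contraNneq x0s => /eqP; rewrite subr_eq0 => /eqP ->.
  rewrite memvB // memv_suml // => i _; apply/memvZ/memv_span.
    by rewrite mem_cat; apply/orP; left; apply: map_f;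
      rewrite mem_iota add0n ltn_ord.
  by rewrite mem_cat; apply/orP; right; apply: map_f;
    rewrite mem_iota add0n ltn_ord.
have [y0 fxy0] : exists y0, f (p x0) y0 != 0.
  have /mem_orthovPn[y _ ?] : p x0 \notin orthov f fullv.
    by rewrite (eqP nd_f) memv0.
  by exists y.
pose x := p x0; pose y := p ((f x y0)^-1 *: y0).
have ox z i : (i < k)%N -> f (p z) (b i) = 0 /\ f (p z) (c i) = 0.
  exact: hyperbolic_residue_orth.
(* Taking the residue of the second vector does not change its pairing with [x], because [x] is
   already orthogonal to every [b i] and [c i]. *)
have fxy : f x y = 1.
  rewrite /y /p /hyperbolic_residue !linearBr /= !linear_sumr /=.
  rewrite [X in _ - (X - _)]big1 => [|i _]; last first.
    by rewrite linearZr /= (ox x0 i _).1 ?mulr0.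
  rewrite big1 => [|i _]; last by rewrite linearZr /= (ox x0 i _).2 ?mulr0.
  by rewrite !subr0 linearZr /= mulVf.
exists (fun i => if i == k then x else b i), (fun i => if i == k then y else c
  i).
move=> i j; rewrite ltnS [(j < _)%N]ltnS (leq_eqVlt i) (leq_eqVlt j).
have fC0 u v : f v u = 0 -> f u v = 0 by move=> fvu;
  rewrite skew_formC fvu oppr0.
have [-> _ | nik /= ik] := eqVneq i k; have [-> _ | njk /= jk] := eqVneq j k.
- by rewrite !alt_f fxy.
- have [? ?] := ox x0 j jk; have [? ?] := ox ((f x y0)^-1 *: y0) j jk.
  by split.
- have [? ?] := ox x0 i ik; have [? ?] := ox ((f x y0)^-1 *: y0) i ik.
  by split; rewrite ?(negPf nik); apply: fC0.
- exact: bc.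
Qed.

End SymplecticBasis.

(** * The hyperbolic quadratic form on V (+) V^* *)

Section HyperbolicForm.

Variable n : nat.
Implicit Types (x y t : sumV n) (A : {'GL_n['F_2]}).

Definition hyperb x : 'F_2 := (x.1 *m x.2^T) 0 0.
Definition polar x y : 'F_2 := (x.1 *m y.2^T) 0 0 + (y.1 *m x.2^T) 0 0.

Lemma hyperbD x y : hyperb (x + y) = hyperb x + hyperb y + polar x y.
Proof.
rewrite /hyperb /polar /= linearD /= mulmxDl !mulmxDr !mxE -!addrA;
  congr (_ + _).
by rewrite addrA addrC addrA addrC.
Qed.

Lemma hyperb_GL x A : hyperb (GLact n x A) = hyperb x.
Proof. by rewrite /hyperb GLact_pairing. Qed.

Lemma addrr_F2 (a : 'F_2) : a + a = 0.
Proof. by rewrite -mulr2n mulrn_pchar // pchar_Fp. Qed.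

Lemma addrr_sumV x : x + x = 0.
Proof. by case: x => a b; congr (_, _); apply/matrixP=> i j;
  rewrite !mxE addrr_F2. Qed.

Lemma neq0_F2 (a : 'F_2) : (a != 0) = (a == 1).
Proof. by case: a => [[|[|]]]. Qed.

(* The row echelon basis of v maps e to v; the transvection 1 + N fixes e and
   corrects the second component. *)
Lemma GLact_unit_vectors x : hyperb x = 1 ->
  exists A, GLact n (delta_mx 0 0, delta_mx 0 0) A = x.
Proof.
case: x => v phi; rewrite /hyperb /= => v_phi.
have v_phiM : v *m phi^T = 1%:M by rewrite [LHS]mx11_scalar v_phi.
pose e : natV n := delta_mx 0 0.
have [A1 A1_unit eA1] : exists2 A1 : 'M['F_2]_n.-1.+1, A1 \in unitmx & e *m A1
  = v.
  exists (row_ebase v); first exact: row_ebase_unit.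
  rewrite -[RHS]mulmx_ebase; congr (_ *m _).
  (* A 1 by 1 invertible matrix over GF(2) is the identity, and [v] has rank 1; the factorisation
     [mulmx_ebase] thus reduces to [e *m row_ebase v = v]. *)
  have -> : col_ebase v = 1%:M.
    have := col_ebase_unit v; rewrite [col_ebase v]mx11_scalar unitmxE
      det_scalar1.
    by rewrite unitfE neq0_F2 => /eqP ->.
  have -> : \rank v = 1%N.
    apply/eqP; rewrite rank_rV; case: (v =P 0) => // v0.
    by move: v_phi; rewrite v0 mul0mx mxE.
  by rewrite mul1mx; apply/matrixP=> i j; rewrite !mxE !ord1 /=;
    case: j => [[]].
pose psi := phi *m A1^T.
have e_psi : e *m psi^T = 1%:M by rewrite trmx_mul trmxK mulmxA eA1.
have e_e : e *m e^T = 1%:M.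
  by rewrite trmx_delta mul_delta_mx; apply/matrixP=> i j; rewrite !mxE !ord1.
pose N := (e^T - psi^T) *m e.
have eN : e *m N = 0 by rewrite mulmxA mulmxBr e_e e_psi subrr mul0mx.
(* Since [e *m N = 0], also [N *m N = 0], so [1%:M - N] is an inverse. *)
have B_unit : 1%:M + N \in unitmx.
  have /mulmx1_unit[] // : (1%:M + N) *m (1%:M - N) = 1%:M.
  rewrite mulmxDl !mulmxBr !mulmx1 !mul1mx -[N *m N]mulmxA eN mulmx0.
  by rewrite subr0 subrK.
have A_unit : (1%:M + N) *m A1 \in unitmx by rewrite unitmx_mul B_unit.
exists (FinRing.Unit A_unit); rewrite /= /GLact_fun /=; congr (_, _).
  by rewrite mulmxA mulmxDr mulmx1 eN addr0.
(* Transposing and clearing the inverse leaves [A *m phi^T = e^T], which holds because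
   [N *m psi^T = e^T - psi^T]. *)
apply: trmx_inj; rewrite trmx_mul trmxK; apply: (canLR (mulKmx A_unit)).
have -> : (1%:M + N) *m A1 *m phi^T = (1%:M + N) *m psi^T.
  by rewrite -mulmxA [psi^T]trmx_mul trmxK.
by rewrite mulmxDl mul1mx -mulmxA e_psi mulmx1 addrC subrK.
Qed.

(** The count runs over the first component [a]: for nonzero [a] the form is a nonzero linear
    functional of the second component and vanishes on half of the space; for [a = 0] it vanishes
    everywhere. *)
Lemma card_hyperb0 : #|[set x | hyperb x == 0]| = (2 ^ n.-1 * (2 ^ n.-1.+1 +
  1))%N.
Proof.
have half (a : natV n) : a != 0 -> #|[set b : natV n | hyperb (a, b) == 0]| =
  (2 ^ n.-1)%N.
  case/rV0Pn => j aj; apply/eqP; rewrite -(eqn_pmul2l (ltn0Sn 1)) -expnS mul2n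
    -addnn.
  (* As [a] has a nonzero coordinate at [j], translation by [b0] exchanges the zeros and nonzeros of
     [hyperb (a, -)]. *)
  pose b0 : natV n := delta_mx 0 j.
  have hD b : hyperb (a, b + b0) = hyperb (a, b) + 1.
    rewrite /hyperb /= linearD mulmxDr mxE; congr (_ + _).
    by rewrite /b0 /= trmx_delta -colE mxE; apply/eqP; rewrite -neq0_F2.
  have {1}-> : [set b | hyperb (a, b) == 0] = [set b + b0 | b in ~: [set b |
    hyperb (a, b) == 0]].
    apply/setP=> b; rewrite !inE -[in RHS](subrK b0 b) (mem_imset _ _ (addIr
      b0)) !inE.
    by rewrite -{1}[b](subrK b0) hD -[1 in LHS](oppr_pchar2 (pchar_Fp (isT :
      prime 2))) subr_eq0 neq0_F2.
  rewrite (card_imset _ (addIr b0)) addnC cardsC card_mx card_Fp // mul1n.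
  by [].
rewrite -sum1dep_card.
transitivity (\sum_a #|[set b : natV n | (hyperb (a, b) == 0)%R]|)%N.
  under [RHS]eq_bigr do rewrite -sum1dep_card.
  by rewrite pair_big_dep /=; apply: eq_bigl => [[a b]].
rewrite (bigD1 0) //= (eq_bigr _ half) sum_nat_const.
have -> : #|[set b : natV n | hyperb (0, b) == 0]| = (2 ^ n.-1.+1)%N.
  rewrite -[RHS](_ : #|natV n| = _); last by rewrite card_mx card_Fp // mul1n.
  by apply: eq_card => b; rewrite !inE /hyperb /= mul0mx mxE eqxx.
have -> : #|(fun a : natV n => a != 0)| = (2 ^ n.-1.+1).-1.
  have := cardC1 (0 : natV n); rewrite card_mx card_Fp // mul1n => <-.
  by apply: eq_card => a; rewrite !inE.
rewrite expnS; have := expn_gt0 2 n.-1; move: (2 ^ n.-1)%N => k k_gt0; nia.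
Qed.

End HyperbolicForm.

(** The coordinates are taken in a symplectic basis; linear independence is never shown directly,
    but follows from [psiK] and a count of vectors. *)
Lemma hyperbolic_coordinates (n : nat) (f : {skew_symmetric 'rV['F_2]_(2 * n)})
  :
    (0 < n)%N -> is_psymplectic f ->
  exists2 phi : {linear 'rV['F_2]_(2 * n) -> sumV n},
    bijective phi & forall u v, f u v = polar (phi u) (phi v).
Proof.
move=> n_gt0 [nd_f _ /(_ (pchar_Fp _)) alt_f].
have nE : n.-1.+1 = n by apply: prednK.
have [|b [c bc]] := hyperbolic_pairs_exist nd_f (alt_f isT) (k := n.-1.+1).
  by rewrite nE dimvf /dim /= mul1n mul2n.
(* Pairing with [c i] reads off the coefficient of [b i], and, signs being immaterial over GF(2),
   pairing with [b i] that of [c i]. *)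
pose phi0 (u : 'rV['F_2]_(2 * n)) : sumV n :=
  (\row_i f u (c (i : 'I_n.-1.+1)), \row_i f u (b (i : 'I_n.-1.+1))).
have phi0_lin : linear phi0.
  move=> a u v; congr (_, _); apply/rowP=> i; rewrite !mxE.
    by rewrite linearDl linearZl_LR.
  by rewrite linearDl linearZl_LR.
pose phiL := GRing.isLinear.Build _ _ _ _ phi0 phi0_lin.
pose phi : {linear 'rV['F_2]_(2 * n) -> sumV n} := HB.pack phi0 phiL.
pose psi (x : sumV n) : 'rV['F_2]_(2 * n) :=
  \sum_i x.1 0 i *: b i + \sum_i x.2 0 i *: c i.
have fcb u v : f u v = f v u by rewrite skew_formC (oppr_pchar2 (pchar_Fp _)).
have f_psi_c x (j : 'I_n.-1.+1) : f (psi x) (c j) = x.1 0 j.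
  rewrite /psi linearDl /= !linear_sumlz /= [X in _ + X]big1 => [|i _];
    last first.
    by have [_ cc _] := bc i j (ltn_ord i) (ltn_ord j);
      rewrite linearZl_LR /= cc mulr0.
  rewrite addr0 (bigD1 j) //= big1 => [|i nij]; last first.
    have [_ _ b_c] := bc i j (ltn_ord i) (ltn_ord j).
    by rewrite linearZl_LR /= b_c (inj_eq val_inj) (negPf nij) mulr0.
  have [_ _ b_c] := bc j j (ltn_ord j) (ltn_ord j).
  by rewrite linearZl_LR /= b_c eqxx mulr1 addr0.
have f_psi_b x (j : 'I_n.-1.+1) : f (psi x) (b j) = x.2 0 j.
  rewrite /psi linearDl /= !linear_sumlz /= big1 => [|i _]; last first.
    by have [bb _ _] := bc i j (ltn_ord i) (ltn_ord j);
      rewrite linearZl_LR /= bb mulr0.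
  rewrite add0r (bigD1 j) //= big1 => [|i nij]; last first.
    have [_ _ b_c] := bc j i (ltn_ord j) (ltn_ord i).
    by rewrite linearZl_LR /= fcb b_c (inj_eq val_inj) eq_sym (negPf nij) mulr0.
  have [_ _ b_c] := bc j j (ltn_ord j) (ltn_ord j).
  by rewrite linearZl_LR /= fcb b_c eqxx mulr1 addr0.
have psiK : cancel psi phi.
  move=> [x y]; rewrite /phi /= /phi0; congr (_, _); apply/rowP=> j;
    rewrite mxE.
    by rewrite f_psi_c.
  by rewrite f_psi_b.
have phiK : cancel phi psi.
  have [|g gK Kg] := inj_card_bij (can_inj psiK).
    by rewrite card_prod !card_mx card_Fp // !mul1n nE mul2n -addnn expnD.
  by move=> u; rewrite -[u]Kg psiK.
exists phi => [|u v]; first by exists psi.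
rewrite -{1}[u]phiK -{1}[v]phiK; move: (phi u) (phi v) => x y.
rewrite {1}/psi linearDl /= !linear_sumlz /= /polar !mxE; congr (_ + _).
  by apply: eq_bigr => i _; rewrite linearZl_LR /= fcb f_psi_b !mxE.
by apply: eq_bigr => i _; rewrite linearZl_LR /= fcb f_psi_c !mxE mulrC.
Qed.

(** * Fibres of a map as a system of imprimitivity *)

Section Fibres.

Variables (P Y : finType) (h : P -> Y) (k : Y -> P).
Hypothesis kK : cancel k h.

(** The section [k] makes [h] surjective, so no fibre on the right is empty. *)
Lemma preim_partition_fibres :
  preim_partition h [set: P] = [set h @^-1: [set y] | y : Y].
Proof.
apply/setP=> C; apply/imsetP/imsetP=> [[p _ ->] | [y _ ->]].
  by exists (h p) => //; apply/setP=> q; rewrite !inE eq_sym.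
by exists (k y) => //; apply/setP=> q; rewrite !inE kK eq_sym.
Qed.

Lemma card_preim_partition : #|preim_partition h [set: P]| = #|Y|.
Proof.
rewrite preim_partition_fibres card_imset // => y z /setP/(_ (k y)).
by rewrite !inE kK eqxx => /esym/eqP.
Qed.

Lemma fibre_imprimitivity_system (aT : finGroupType) (G : {group aT})
    (to : {action aT &-> P}) :
    (forall a p q, a \in G -> h p = h q -> h (to p a) = h (to q a)) ->
    (1 < #|Y| < #|P|)%N ->
  imprimitivity_system G [set: P] to (preim_partition h [set: P]).
Proof.
move=> hG cardY; apply/and3P; split; first exact: preim_partitionP.
  apply/subsetP=> a Ga; rewrite !inE; apply/subsetP=> _ /imsetP[p _ ->].
  rewrite inE; apply/imsetP; exists (to p a) => //.
  apply/setP=> q; rewrite !inE; apply/imsetP/eqP=> [[r] | hpq].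
    by rewrite !inE => /eqP hpr ->; apply: hG.
  (* The reverse inclusion applies the hypothesis on [h] to the inverse of [a]. *)
  exists (to q a^-1%g); last by rewrite actKV.
  by rewrite !inE -[p in h p](actK to a); apply/eqP/hG; rewrite ?groupV.
by rewrite card_preim_partition cardsT.
Qed.

End Fibres.

(** * Cosets of V and V^*, and the grid they form *)

Section PulledCosets.

Variables (n : nat) (P : finType) (phi : P -> sumV n) (phi' : sumV n -> P).
Hypothesis phi'K : cancel phi' phi.

(** V is the kernel of the second projection, so its cosets are the fibres of that projection; this
    brings them under the results on fibres. *)
Lemma pulled_cosets_summand1 :
  pulled_cosets phi (summand1 n) = preim_partition (fun p => (phi p).2) [set:
    P].
Proof.
rewrite (preim_partition_fibres (k := fun y => phi' (0, y))); last first.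
  by move=> y; rewrite phi'K.
apply/setP=> C; apply/imsetP/imsetP=> [[_ /rcosetsP[x _ ->] ->] | [y _ ->]].
  exists x.2 => //; apply/setP=> p.
  by rewrite !inE mem_rcoset inE /= subr_eq0.
exists (summand1 n :* ((0, y) : sumV n))%g; first by apply/rcosetsP; eexists;
  rewrite ?inE.
apply/setP=> p.
by rewrite !inE mem_rcoset inE /= subr_eq0.
Qed.

Lemma pulled_cosets_summand2 :
  pulled_cosets phi (summand2 n) = preim_partition (fun p => (phi p).1) [set:
    P].
Proof.
rewrite (preim_partition_fibres (k := fun y => phi' (y, 0))); last first.
  by move=> y; rewrite phi'K.
apply/setP=> C; apply/imsetP/imsetP=> [[_ /rcosetsP[x _ ->] ->] | [y _ ->]].
  exists x.1 => //; apply/setP=> p.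
  by rewrite !inE mem_rcoset inE /= subr_eq0.
exists (summand2 n :* ((y, 0) : sumV n))%g; first by apply/rcosetsP; eexists;
  rewrite ?inE.
apply/setP=> p.
by rewrite !inE mem_rcoset inE /= subr_eq0.
Qed.

(** A row fixes the second component and a column the first, so they meet in the preimage of one
    pair. *)
Lemma pulled_cosets_grid : cancel phi phi' ->
  square_grid (2 ^ n.-1.+1) (pulled_cosets phi (summand1 n))
    (pulled_cosets phi (summand2 n)).
Proof.
move=> phiK; rewrite pulled_cosets_summand1 pulled_cosets_summand2.
have k2 : cancel (fun y => phi' (0, y)) (fun p => (phi p).2).
  by move=> y; rewrite phi'K.
have k1 : cancel (fun y => phi' (y, 0)) (fun p => (phi p).1).
  by move=> y; rewrite phi'K.
split; try exact: preim_partitionP.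
- by rewrite (card_preim_partition k2) card_mx card_Fp // mul1n.
- by rewrite (card_preim_partition k1) card_mx card_Fp // mul1n.
rewrite (preim_partition_fibres k1) (preim_partition_fibres k2).
move=> _ _ /imsetP[y _ ->] /imsetP[x _ ->].
suff -> : (fun p => (phi p).2) @^-1: [set y] :&: (fun p => (phi p).1) @^-1:
  [set x]
          = [set phi' (x, y)] by rewrite cards1.
apply/setP=> p; rewrite !inE -(can2_eq phiK phi'K).
by case: (phi p) => a b; rewrite xpair_eqE andbC.
Qed.

End PulledCosets.

(** * Transport of an action along a bijection *)

Section TransportedAction.

Variables (aT : finGroupType) (T U : finType) (to : {action aT &-> U}).
Variables (h : T -> U) (k : U -> T).
Hypotheses (hK : cancel h k) (kK : cancel k h).

Definition transport_fun t a := k (to (h t) a).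

Lemma transport1 : transport_fun^~ 1%g =1 id.
Proof. by move=> t; rewrite /transport_fun act1 hK. Qed.

Lemma transportM t : act_morph transport_fun t.
Proof. by move=> a b; rewrite /transport_fun actM kK. Qed.

Definition transport_act : {action aT &-> T} := TotalAction transport1
  transportM.

Lemma transport_actE t a : h (transport_act t a) = to (h t) a.
Proof. exact: kK. Qed.

End TransportedAction.

(** * The affine group acting on V (+) V^* *)

Section AffineAction.

Variable n : nat.
Implicit Types (x y : sumV n) (g : affGL n).

Lemma GLactD x y (A : {'GL_n['F_2]}) : GLact n (x + y) A = GLact n x A + GLact
  n y A.
Proof. by rewrite /= /GLact_fun !mulmxDl. Qed.

Lemma GLact0 (A : {'GL_n['F_2]}) : GLact n 0 A = 0.
Proof. by apply: (addrI (GLact n 0 A)); rewrite -GLactD !addr0. Qed.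

(** The linear part acts before the translation, matching the product (A, s)(B, t) = (AB, sB + t) of
    the semidirect product. *)
Definition aff_act_fun x g : sumV n := GLact n x g.1 + g.2.

Lemma aff_act1 : aff_act_fun^~ 1%g =1 id.
Proof. by move=> x; exact: (etrans (addr0 _) (act1 (GLact n) x)). Qed.

Lemma aff_actM x : act_morph aff_act_fun x.
Proof. by move=> g h; rewrite /aff_act_fun GLactD -addrA -(actM (GLact n)). Qed.

Definition aff_act : {action affGL n &-> sumV n} := TotalAction aff_act1
  aff_actM.

Lemma aff_act_sdpair1 x t : aff_act x (sdpair1 (GLgact n) t) = x + t.
Proof. by rewrite /= /aff_act_fun val_insubd !inE; congr (_ + _);
  apply: GLact1. Qed.

Lemma aff_act_sdpair2 x A : aff_act x (sdpair2 (GLgact n) A) = GLact n x A.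
Proof. by rewrite /aff_act /= /aff_act_fun val_insubd !inE /= addr0. Qed.

(** The image of 0 determines the translation; the vectors of V alone then determine the matrix. *)
Lemma aff_act_faithful g : (forall x, aff_act x g = x) -> g = 1%g.
Proof.
move=> gx; apply: val_inj; case: g gx => [[A t] /= At] gx.
have t0 : t = 0 :> sumV n.
  have gx0 : GLact n 0 A + t = 0 := gx 0.
  by rewrite GLact0 add0r in gx0.
congr (_, _) => //; apply: val_inj; apply/row_matrixP=> i.
have gxi : GLact n (delta_mx 0 i, 0) A + t = (delta_mx 0 i, 0) := gx _.
by move: gxi; rewrite t0 addr0 !rowE mulmx1 => -[].
Qed.

(* Over GF(2) the two translation parts of g cancel. *)
Lemma hyperb_aff_act x y g : hyperb (aff_act x g + aff_act y g) = hyperb (x +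
  y).
Proof. by rewrite /= /aff_act_fun addrACA addrr_sumV addr0 -GLactD hyperb_GL.
  Qed.

End AffineAction.

(** Over GF(2) the scalars are 0 and 1, so additivity already gives linearity. *)
Lemma additive_rowE (m : nat) (g : 'rV['F_2]_m -> 'F_2) :
    {morph g : a b / a + b} ->
  forall a, g a = \sum_i a 0 i * g (delta_mx 0 i).
Proof.
move=> gD a.
have g0 : g 0 = 0 by apply: (addrI (g 0)); rewrite -gD !addr0.
rewrite [in LHS](row_sum_delta a) (big_morph g gD g0); apply: eq_bigr => i _.
have [-> | ] := eqVneq (a 0 i) 0; first by rewrite scale0r mul0r.
by rewrite neq0_F2 => /eqP ->; rewrite scale1r mul1r.
Qed.

(** * Representing additive functionals by the polar form *)

Section PolarDuality.

Variable n : nat.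
Implicit Types (x y u : sumV n) (d : sumV n -> 'F_2).

Lemma polarDl x y u : polar (x + y) u = polar x u + polar y u.
Proof. by rewrite /polar /= linearD /= mulmxDl mulmxDr !mxE addrACA. Qed.

(** The vector representing [d] through [polar]. Its components are swapped because [polar] pairs V
    with V^*. *)
Definition polar_dual d : sumV n :=
  (\row_i d (0, delta_mx 0 i), \row_i d (delta_mx 0 i, 0)).

Lemma eq_polar_dual d d' : d =1 d' -> polar_dual d = polar_dual d'.
Proof. by move=> dd'; congr (_, _); apply/rowP=> i; rewrite !mxE dd'. Qed.

Lemma polar_dualE d :
  {morph d : x y / x + y} -> forall x, d x = polar x (polar_dual d).
Proof.
move=> dD [a b].
have -> : (a, b) = (a, 0) + (0, b) :> sumV n.
  by rewrite -[RHS]/(a + 0, 0 + b) addr0 add0r.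
have dD1 : {morph (fun x : natV n => d (x, 0)) : x y / x + y}.
  by move=> x y; rewrite -dD; congr d; congr (_, _); rewrite /= addr0.
have dD2 : {morph (fun x : natV n => d (0, x)) : x y / x + y}.
  by move=> x y; rewrite -dD; congr d; congr (_, _); rewrite /= addr0.
rewrite dD (additive_rowE dD1) (additive_rowE dD2) /polar /= addr0 add0r !mxE.
congr (_ + _); apply: eq_bigr => i _; rewrite !mxE //.
by rewrite mulrC.
Qed.

Lemma polar_dualK u : polar_dual (fun x => polar x u) = u.
Proof.
case: u => a b; congr (_, _); apply/rowP=> i; rewrite !mxE /polar /=.
  by rewrite mul0mx mxE add0r trmx_delta -colE mxE.
by rewrite trmx0 mulmx0 [X in _ + X]mxE addr0 -rowE !mxE.
Qed.

End PolarDuality.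

(** * Blocks parametrised by vectors, their types and incidence *)

Section Blocks.

Variables (n : nat) (f : {skew_symmetric 'rV['F_2]_(2 * n)}).
Variables (phi : {linear 'rV['F_2]_(2 * n) -> sumV n}).
Variables (phi' : sumV n -> 'rV['F_2]_(2 * n)).
Hypotheses (n_gt0 : (0 < n)%N) (phiK : cancel phi phi') (phi'K : cancel phi'
  phi).
Hypothesis fE : forall v w, f v w = polar (phi v) (phi w).
Implicit Types (u : sumV n) (w : 'rV['F_2]_(2 * n)).

Definition block_fun u : {ffun 'rV['F_2]_(2 * n) -> 'F_2} :=
  [ffun w => hyperb (phi w) + polar (phi w) u].

Lemma block_fun_polarises u : polarises f (block_fun u).
Proof.
apply/'forall_forallP => v w; rewrite !ffunE linearD polarDl hyperbD fE.
by apply/eqP; ring.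
Qed.

Definition block u : quad_form f := Sub (block_fun u) (block_fun_polarises u).

(** Two forms with the same polarisation differ by an additive functional, here written as a sum in
    characteristic 2; its representing vector is the parameter of the block. *)
Definition block_center (Q : quad_form f) : sumV n :=
  polar_dual (fun x => val Q (phi' x) + hyperb x).

Lemma block_centerK : cancel block_center block.
Proof.
move=> Q; apply/val_inj/ffunP=> w; rewrite ffunE -polar_dualE.
  by rewrite phiK addrCA addrr_F2 addr0.
have /'forall_forallP Qf := valP Q.
have phi'D : {morph phi' : x y / x + y}.
  by move=> x y; apply: (can_inj phiK); rewrite linearD !phi'K.
move=> x y; rewrite phi'D (eqP (Qf _ _)) hyperbD fE !phi'K.
(* Characteristic 2 is invisible to [ring], so the term occurring twice on the left is first added
   twice on the right. *)
rewrite -[RHS]addr0 -(addrr_F2 (polar x y)); ring.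
Qed.

Lemma blockK : cancel block block_center.
Proof.
move=> u; rewrite -[RHS]polar_dualK; apply: eq_polar_dual => x.
by rewrite ffunE phi'K addrAC addrr_F2 add0r.
Qed.

Lemma block_funE u w : block_fun u w = hyperb (phi w + u) + hyperb u.
Proof. by rewrite ffunE hyperbD -[LHS]addr0 -(addrr_F2 (hyperb u)); ring. Qed.

(** Up to translation the zeros of the form are the vectors where [hyperb] equals [hyperb u]: the
    zeros of [hyperb], or their complement. *)
Lemma tp_block_fun u : tp (block_fun u) = (-1) ^+ (hyperb u : nat).
Proof.
have nE : n.-1.+1 = n by apply: prednK.
have cV : #|{: sumV n}| = (2 ^ n * 2 ^ n)%N.
  by rewrite card_prod !card_mx card_Fp // !mul1n nE.
have c0 : #|[set x : sumV n | hyperb x == 0]| = (2 ^ n.-1 * (2 ^ n + 1))%N.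
  by rewrite card_hyperb0 nE.
have tr_bij : bijective (fun w => phi w + u).
  by exists (fun x => phi' (x - u)) => [w | x]; rewrite ?addrK ?phi'K ?subrK.
have -> : tp (block_fun u) =
    if #|[set x : sumV n | hyperb x == hyperb u]| == #|[set x : sumV n | hyperb
      x == 0]|
    then 1 else -1.
  rewrite /tp -c0; congr (if _ == _ then _ else _).
  rewrite -(on_card_preimset (onW_bij _ tr_bij)).
  apply: eq_card => w; rewrite !inE block_funE.
  by rewrite -[X in _ + X](oppr_pchar2 (pchar_Fp (isT : prime 2))) subr_eq0.
have [-> | ] := eqVneq (hyperb u) 0; first by rewrite eqxx.
rewrite neq0_F2 => /eqP ->.
have -> : [set x : sumV n | hyperb x == 1] = ~: [set x : sumV n | hyperb x ==
  0].
  by apply/setP=> x; rewrite !inE neq0_F2.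
(* If the complement had the plus-type cardinality too, the zeros of [hyperb] would be exactly half
   of the space, contradicting the count. *)
have := cardsC [set x : sumV n | hyperb x == 0]; rewrite cV c0.
have -> : (2 ^ n = 2 * 2 ^ n.-1)%N by rewrite -expnS nE.
case: eqP => // ->; have := expn_gt0 2 n.-1.
by move: (2 ^ n.-1)%N => k; nia.
Qed.

(** The sign of [hyperb u] occurs both in the value of the form and in its type, and cancels. *)
Lemma incident_block w u : incident (-1) w (block u) = (hyperb (phi w + u) ==
  1).
Proof.
rewrite /incident /= tp_block_fun block_funE sign_F2D.
by rewrite -neq0_F2; case: (hyperb _) (hyperb u) => [[|[|[]]] //= ?] [[|[|[]]]
  //= ?].
Qed.

End Blocks.

(** * The affine group as a flag-transitive group of automorphisms *)

Theorem mainTheorem5 (n : nat) (hn : (2 <= n)%N)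
    (f : {skew_symmetric 'rV['F_2]_(2 * n)}) (hf : is_psymplectic f) :
  let W := 'rV['F_2]_(2 * n) in
  let I : W -> quad_form f -> bool := @incident n (-1) f in
  exists (G : {group {perm W} * {perm quad_form f}})
         (psi : {morphism [set: affGL n] >->
                          ({perm W} * {perm quad_form f})%type})
         (phi : {linear W -> sumV n}),
    [/\ G \subset inc_aut I,
        isom [set: affGL n] G psi,
        [transitive G, on flags I | flag_act],
        [transitive G, on [set: W] | point_act] /\
          ~~ [primitive G, on [set: W] | point_act]
      & [/\ bijective phi,
            forall (t : sumV n) (w : W),
              phi ((psi (sdpair1 (GLgact n) t)).1 w) = phi w + t,
            forall (A : {'GL_n['F_2]}) (w : W),
              phi ((psi (sdpair2 (GLgact n) A)).1 w) = GLact n (phi w) A,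
            imprimitivity_system G [set: W] point_act
              (pulled_cosets phi (summand1 n)) /\
            imprimitivity_system G [set: W] point_act
              (pulled_cosets phi (summand2 n))
          & square_grid (2 ^ n) (pulled_cosets phi (summand1 n))
              (pulled_cosets phi (summand2 n))]].
Proof.
move=> W I.
have n_gt0 : (0 < n)%N := ltnW hn.
have nE : n.-1.+1 = n by apply: prednK.
have [phi [phi' phiK phi'K] fE] := hyperbolic_coordinates n_gt0 hf.
pose gamma := block fE; pose gamma' := @block_center n f phi'.
have gammaK : cancel gamma gamma' by apply: blockK.
have gamma'K : cancel gamma' gamma by apply: block_centerK.
have IE w Q : I w Q = (hyperb (phi w + gamma' Q) == 1).
  by rewrite -{1}[Q]gamma'K; apply: incident_block.
(* One affine action is carried both to the points, through [phi], and to the blocks, through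
   [gamma']. *)
pose toW := transport_act (aff_act n) phiK phi'K.
pose toQ := transport_act (aff_act n) gamma'K gammaK.
pose psi0 g := (actperm toW g, actperm toQ g).
have psiM : {in [set: affGL n] &, {morph psi0 : g h / (g * h)%g}}.
  by move=> g h _ _; rewrite /psi0 !actpermM ?inE.
pose psi := Morphism psiM; pose G := (psi @* [set: affGL n])%G.
have psiW g w : phi ((psi g).1 w) = aff_act n (phi w) g.
  by rewrite /= actpermE transport_actE.
have psiQ g Q : gamma' ((psi g).2 Q) = aff_act n (gamma' Q) g.
  by rewrite /= actpermE transport_actE.
have Gpsi g : psi g \in G by rewrite mem_morphim ?inE.
have G_psi a : a \in G -> exists g, a = psi g by case/morphimP=> g _ _;
  exists g.
have psi_t t w : phi ((psi (sdpair1 (GLgact n) t)).1 w) = phi w + t.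
  by rewrite psiW aff_act_sdpair1.
have psi_A A w : phi ((psi (sdpair2 (GLgact n) A)).1 w) = GLact n (phi w) A.
  by rewrite psiW aff_act_sdpair2.
have trW v w : exists2 a, a \in G & w = point_act v a.
  exists (psi (sdpair1 (GLgact n) (phi w - phi v))) => //.
  by apply: (can_inj phiK); rewrite psi_t addrC subrK.
have card_V : #|natV n| = (2 ^ n)%N by rewrite card_mx card_Fp // mul1n nE.
have cardV : (1 < #|natV n| < #|W|)%N.
  by rewrite card_V card_mx card_Fp // mul1n -{1}(expn0 2) !ltn_exp2l //; lia.
have sys1 : imprimitivity_system G [set: W] point_act (pulled_cosets phi
  (summand1 n)).
  rewrite (pulled_cosets_summand1 phi'K).
  apply: (@fibre_imprimitivity_system _ _ _ (fun y => phi' (0, y))) => //.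
    by move=> y; rewrite phi'K.
  move=> _ v w /G_psi[g ->] e.
  by rewrite /point_act /= /point_act_fun !psiW /= e.
have sys2 : imprimitivity_system G [set: W] point_act (pulled_cosets phi
  (summand2 n)).
  rewrite (pulled_cosets_summand2 phi'K).
  apply: (@fibre_imprimitivity_system _ _ _ (fun y => phi' (y, 0))) => //.
    by move=> y; rewrite phi'K.
  move=> _ v w /G_psi[g ->] e.
  by rewrite /point_act /= /point_act_fun !psiW /= e.
have autG a w Q : a \in G -> I (a.1 w) (a.2 Q) = I w Q.
  by case/G_psi=> g ->; rewrite !IE psiW psiQ hyperb_aff_act.
exists G, psi, phi; split.
- by apply/subsetP=> a Ga; apply/inc_autP=> w Q; apply: autG.
- apply/isomP; split=> //; apply/subsetP=> g /morphpreP[_ /set1P psi_g];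
  apply/set1P.
  apply: aff_act_faithful => x; have := psiW g (phi' x).
  by rewrite psi_g perm1 phi'K.
(* The base flag is the point 0 with the block of parameter [e]. *)
- pose e : sumV n := (delta_mx 0 0, delta_mx 0 0).
  have e1 : hyperb e = 1 by rewrite /hyperb trmx_delta mul_delta_mx !mxE.
  apply/imsetP; exists (0, gamma e); first by rewrite inE IE gammaK linear0
    add0r e1.
  apply/setP=> -[w Q]; rewrite inE; apply/idP/imsetP=> [| [a Ga [-> ->]]];
    last first.
    by rewrite autG // IE gammaK linear0 add0r e1.
  rewrite IE => /eqP/GLact_unit_vectors[A eA].
  (* [A] maps [e] to [phi w + gamma' Q] and fixes 0; translating by [phi w] then gives the point [w]
     and, as [phi w] cancels, the parameter [gamma' Q]. *)
  exists (psi (sdpair2 (GLgact n) A * sdpair1 (GLgact n) (phi w))%g);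
    first exact: Gpsi.
  apply: injective_projections; [apply: (can_inj phiK) | apply: (can_inj
    gamma'K)].
    apply/esym/(etrans (psiW _ _)).
    by rewrite actM aff_act_sdpair2 aff_act_sdpair1 linear0 GLact0 add0r.
  apply/esym/(etrans (psiQ _ _)); rewrite gammaK actM aff_act_sdpair2
    aff_act_sdpair1 eA.
  by rewrite addrAC addrr_sumV add0r.
- split.
    apply/imsetP; exists (0 : W) => //; apply/setP=> w; rewrite inE.
    by apply/esym/imsetP; apply: trW.
  rewrite negb_and; apply/orP; right; rewrite negbK; apply/existsP.
  by exists (pulled_cosets phi (summand1 n)).
split=> //; first by exists phi'.
by rewrite -[X in (2 ^ X)%N]nE; apply: pulled_cosets_grid phi'K phiK.
Qed.
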